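(* Let $(Y,+,d)$ be a complete metric abelian group and let $S$ be a closed pointed additively controllable subsemigroup of $Y$. Then the partially ordered set $(Y,\leq_S)$ is lower chain-complete.
   Context: A metric abelian group $(Y,+,d)$ is an abelian group $(Y,+)$ with a metric $d$ on $Y$ that is translation invariant: $d(x+z,y+z)=d(x,y)$ for all $x,y,z\in Y$; complete means $(Y,d)$ is a complete metric space. Put $\|x\|_d:=d(x,0)$. A nonempty subsemigroup $S$ of $(Y,+)$ is pointed if $0\in S$, and salient if $S\cap(-S)\subseteq\{0\}$. It is additively controllable if there exists a continuous additive function $a:Y\to\mathbb{R}$ such that $\|y\|_d\leq a(y)$ for all $y\in S$. (Additively controllable subsemigroups are automatically salient.) A pointed salient subsemigroup $S$ induces the partial order $\leq_S$ on $Y$ defined by $x\leq_S y$ iff $y-x\in S$. A partially ordered set is lower chain-complete if every nonempty chain (totally ordered subset) that is bounded below has an infimum. *)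

(* Defs.v *)
From HB Require Import structures.
From mathcomp Require Import all_boot all_order all_algebra.
From mathcomp Require Import all_classical all_reals topology_theory.topology.

Set Implicit Arguments.
Unset Strict Implicit.
Unset Printing Implicit Defensive.

Import Order.TTheory GRing.Theory Num.Theory.
Import numFieldTopology.Exports.

Local Open Scope classical_set_scope.
Local Open Scope ring_scope.

(* Only the topology layer is loaded above: once the library's
   pseudoMetricNormedZmodType is in scope, HB rejects a structure joining
   Metric and Zmodule without the (inappropriate) normed Z-module axioms. *)
HB.mixin Record Metric_isTranslationInvariant (R : realType) Y
    & Metric R Y & GRing.Zmodule Y := {
  mdistDr : forall x y z : Y, mdist (x + z) (y + z) = mdist x y
}.

#[short(type="metricAbelianGroupType")]
HB.structure Definition MetricAbelianGroup (R : realType) :=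
  { Y of Metric R Y & GRing.Zmodule Y & Metric_isTranslationInvariant R Y }.

(* [Complete] brings along the [isPointed] mixin of the library: an arbitrary
   distinguished element, unrelated to the algebraic or metric structure. *)
#[short(type="completeMetricAbelianGroupType")]
HB.structure Definition CompleteMetricAbelianGroup (R : realType) :=
  { Y of MetricAbelianGroup R Y & Complete Y }.

Definition metric_norm (R : realType) (Y : metricAbelianGroupType R) (x : Y) : R :=
  mdist x 0.

Section Subsemigroups.
Variable Y : zmodType.
Implicit Type S : set Y.

Definition subsemigroup S :=
  S !=set0 /\ (forall x y, S x -> S y -> S (x + y)).

Definition pointed_set S := S 0.

Definition salient S := S `&` [set - x | x in S] `<=` [set 0].

End Subsemigroups.

Definition additively_controllable (R : realType) (Y : metricAbelianGroupType R)
    (S : set Y) :=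
  exists a : {additive Y -> R},
    continuous a /\ (forall y, S y -> metric_norm y <= a y).

Lemma additively_controllable_salient (R : realType)
    (Y : metricAbelianGroupType R) (S : set Y) :
  additively_controllable S -> salient S.
Proof.
move=> [a [_ Sa]] y [Sy [z Sz zy]].
have ay0 : 0 <= a y by apply: le_trans (Sa _ Sy); exact: mdist_ge0.
have az0 : 0 <= a z by apply: le_trans (Sa _ Sz); exact: mdist_ge0.
have ay : a y = 0.
  by apply/eqP; rewrite eq_le ay0 andbT -zy raddfN oppr_le0.
apply: (@mdist_positivity R Y); apply/eqP.
by rewrite eq_le mdist_ge0 andbT -[leRHS]ay; exact: Sa.
Qed.

(* [induced_order subS ptS saS] is [Y] equipped with the order <=_S. The proofs
   are parameters of the type so that the order instance can be found. *)
Section InducedOrder.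
Variables (Y : zmodType) (S : set Y).

Definition induced_order (subS : subsemigroup S) (ptS : pointed_set S)
  (saS : salient S) : Type := Y.

Variables (subS : subsemigroup S) (ptS : pointed_set S) (saS : salient S).
Local Notation T := (induced_order subS ptS saS).

Definition induced_le (x y : Y) : bool := `[< S (y - x) >].

Lemma induced_le_refl : reflexive induced_le.
Proof. by move=> x; apply/asboolP; rewrite subrr. Qed.

Lemma induced_le_anti : antisymmetric induced_le.
Proof.
move=> x y /andP[/asboolP Sxy /asboolP Syx]; apply/eqP; rewrite -subr_eq0.
by apply/eqP/saS; split=> //; exists (y - x) => //; rewrite opprB.
Qed.

Lemma induced_le_trans : transitive induced_le.
Proof.
move=> y x z /asboolP Sxy /asboolP Syz; apply/asboolP.
by rewrite -(subrK y z) -addrA; exact: subS.2.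
Qed.

HB.instance Definition _ := Choice.copy T Y.
HB.instance Definition _ := Order.Le_isPOrder.Build (Order.Disp tt tt) T
  induced_le_refl induced_le_anti induced_le_trans.

End InducedOrder.

Definition lower_chain_complete (d : Order.disp_t) (T : porderType d) :=
  forall C : set T, C !=set0 -> total_on C (fun x y => (x <= y)%O) ->
    has_lbound C -> infimums C !=set0.

(* Main.v *)
Require Import Defs.
From mathcomp Require Import all_boot all_order all_algebra.
From mathcomp Require Import all_classical all_reals topology_theory.topology.

(** If [a] controls [S], then [d (x, y) <= `|a x - a y|] whenever [x] and [y] are
comparable. On a chain bounded below, [a] is bounded below, so the filter
generated by the initial segments of the chain is Cauchy. It converges by
completeness, and since [S] is closed its limit is the infimum of the chain. *)

Set Implicit Arguments.
Unset Strict Implicit.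
Unset Printing Implicit Defensive.

Import Order.TTheory GRing.Theory Num.Theory.
Import numFieldTopology.Exports.

Local Open Scope classical_set_scope.
Local Open Scope ring_scope.

Section MetricAbelianGroupTheory.
Variables (R : realType) (Y : metricAbelianGroupType R).
Implicit Types x y z : Y.

Lemma metric_norm_sub x y : metric_norm (x - y) = mdist x y.
Proof. by rewrite /metric_norm -(mdistDr _ _ y) subrK add0r. Qed.

(** Translation by [x + y] sends [- x] to [y] and [- y] to [x]; symmetry of the metric does the
    rest. *)
Lemma mdistN x y : mdist (- x) (- y) = mdist x y.
Proof. by rewrite -(mdistDr _ _ (x + y)) addKr addrCA addNr addr0 metric_sym. Qed.

Lemma isometry_continuous (f : Y -> Y) :
  (forall x y, mdist (f x) (f y) = mdist x y) -> continuous f.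
Proof.
move=> isof x; apply/cvg_ballP => e e0; near=> y.
rewrite ballEmdist /= isof.
have : ball x e y by near: y; exact: nbhsx_ballx.
by rewrite ballEmdist.
Unshelve. all: by end_near. Qed.

Lemma addr_continuous z : continuous (fun x => x + z).
Proof. by apply: isometry_continuous => x y; exact: mdistDr. Qed.

Lemma subr_continuous z : continuous (fun x => z - x).
Proof.
by apply: isometry_continuous => x y; rewrite ![z - _]addrC mdistDr mdistN.
Qed.

End MetricAbelianGroupTheory.

Section ChainFilter.
Variables (Y : zmodType) (S : set Y).
Hypotheses (subS : subsemigroup S) (ptS : pointed_set S).
Variable C : set Y.
Hypotheses (C0 : C !=set0)
  (totC : forall x y, C x -> C y -> S (y - x) \/ S (x - y)).

Definition initial_segment (c : Y) : set Y := [set x | C x /\ S (c - x)].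

(** The chain read downwards as a net: a property holds eventually when it holds on the chain below
    some [c] in [C]. *)
Definition chain_filter : set_system Y := filter_from C initial_segment.

Lemma initial_segment_sub c c' :
  S (c' - c) -> initial_segment c `<=` initial_segment c'.
Proof.
move=> Sc'c x [Cx Scx]; split=> //.
by rewrite -(subrK c c') -addrA; exact: subS.2.
Qed.

(** Totality nests any two segments, so the smaller one lies in their intersection; [c] belongs to
    its own segment because [0] is in [S]. *)
Lemma chain_filter_proper : ProperFilter chain_filter.
Proof.
apply: filter_from_proper; last by move=> c Cc; exists c; split; rewrite ?subrr.
apply: filter_from_filter => // c c' Cc Cc'.
have [le|le] := totC Cc Cc'.
- by exists c => // x cx; split=> //; exact: initial_segment_sub cx.
- by exists c' => // x cx; split=> //; exact: initial_segment_sub cx.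
Qed.

End ChainFilter.

Lemma chain_filter_cauchy (R : realType) (Y : metricAbelianGroupType R)
    (S C : set Y) (b : Y) :
  additively_controllable S -> C !=set0 ->
  (forall x, C x -> S (x - b)) ->
  ProperFilter (chain_filter S C) -> cauchy (chain_filter S C).
Proof.
move=> [a [_ aS]] C0 bC PF; apply: cauchy_exP => e e0.
have aS0 y : S y -> 0 <= a y.
  by move=> Sy; exact: le_trans (mdist_ge0 _ _) (aS _ Sy).
have lbaC : has_lbound (a @` C).
  by exists (a b) => _ [x Cx <-]; rewrite -subr_ge0 -raddfB; exact/aS0/bC.
have infaC : has_inf (a @` C) by split=> //; case: C0 => c Cc; exists (a c), c.
have [_ [c Cc <-] ace] := inf_adherent e0 infaC.
exists c, c => // x [Cx Scx]; rewrite ballEmdist /= -metric_norm_sub.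
apply: le_lt_trans (aS _ Scx) _; rewrite raddfB ltrBlDl.
apply: lt_le_trans ace _; rewrite lerD2r.
by apply: ge_inf => //; exists x.
Qed.

Theorem theorem3p2 (R : realType) (Y : completeMetricAbelianGroupType R)
    (S : set Y) (subS : subsemigroup S) (clS : closed S) (ptS : pointed_set S)
    (ctS : additively_controllable S) :
  lower_chain_complete
    (induced_order subS ptS (additively_controllable_salient ctS)).
Proof.
move=> C C0 totC [b lbb].
have totS (x y : Y) : C x -> C y -> S (y - x) \/ S (x - y).
  by move=> Cx Cy; have [/asboolP|/asboolP] := totC x y Cx Cy; [left|right].
have PF : ProperFilter (chain_filter S (C : set Y)).
  exact: chain_filter_proper.
have Fl : cvg (chain_filter S (C : set Y)).
  apply: cauchy_cvg; apply: (@chain_filter_cauchy _ _ _ _ b) => // x Cx.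
  by apply/asboolP; exact: lbb.
set F := chain_filter S (C : set Y) in PF Fl.
set l : Y := lim F in Fl.
exists l; split=> [c Cc|b' lbb'].
(* Lower bound: [c - x] is in [S] for all [x] in the segment of [c], and the closed set [S] keeps
   the limit [c - l]. *)
- apply/asboolP; apply: (@closed_cvg _ _ F _ (fun x : Y => c - x : Y) S clS).
    by exists c => // x [].
  exact: (cvg_comp _ _ Fl (@subr_continuous _ _ c l)).
(* Greatest: [x - b'] is in [S] on the whole chain, hence on any segment, so the limit [l - b'] is
   in [S] too. *)
- apply/asboolP; apply: (@closed_cvg _ _ F _ (fun x : Y => x - b' : Y) S clS).
    have [c Cc] := C0; exists c => // x [Cx _].
    by apply/asboolP; exact: lbb'.
  exact: (cvg_comp _ _ Fl (@addr_continuous _ _ (- b') l)).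
Qed.
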